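(* Let $R$ be a Noetherian commutative ring and let $I\subset R$ be an ideal of height $h$. Then for every integer $j$ with $1\le j\le h-1$ we have $$\sqrt{\mathrm{Fitt}_j(I)}=\sqrt{I}.$$
   Context: For a finitely generated module $M$ over a Noetherian ring $R$, choose a finite free presentation $G\to F\to M\to 0$ with $\mathrm{rank}\,F=r$, and let $A$ be a matrix representing $G\to F$. The $j$th Fitting ideal of $M$ is $\mathrm{Fitt}_j(M)=I_{r-j}(A)$, where $I_t(A)$ is the ideal generated by the $t$-minors of $A$, with $I_t(A)=R$ for $t\le 0$. This is independent of the choices. An ideal $I$ is regarded as an $R$-module. *)

(* Defs.v *)
From HB Require Import structures.
From mathcomp Require Import all_boot all_order all_algebra.
From mathcomp Require Import boolp classical_sets cardinality.
From mathcomp Require Import constructive_ereal.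

Set Implicit Arguments.
Unset Strict Implicit.
Unset Printing Implicit Defensive.

Import Order.TTheory GRing.Theory Num.Theory.
Local Open Scope classical_set_scope.
Local Open Scope ring_scope.

(* An ideal of R is a submodule of the regular module R^o. The membership
   predicates of MathComp are boolean; since classical logic is available this
   is no restriction. The unit ideal is allowed, unlike in [idealr R], and R
   may be the zero ring. *)

Definition ideal_gen (R : comPzRingType) (S : set R) : set R :=
  \bigcap_(J in [set J : submodClosed R^o | S `<=` [set` J]]) [set` J].

Definition noetherian (R : comPzRingType) : Prop :=
  forall J : submodClosed R^o,
    exists2 S : set R, finite_set S & [set` J] = ideal_gen S.

Definition radical (R : comPzRingType) (J : set R) : set R :=
  [set x | exists n : nat, J (x ^+ n)].

Definition prime_ideal (R : comPzRingType) (P : submodClosed R^o) : Prop :=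
  (1 : R) \notin P /\
  forall x y : R, x * y \in P -> (x \in P) || (y \in P).

Definition prime_chain (R : comPzRingType) (P : submodClosed R^o) (n : nat) :
    Prop :=
  exists p : 'I_n.+1 -> submodClosed R^o,
    [/\ forall i, prime_ideal (p i),
        forall i j : 'I_n.+1, (i < j)%N -> [set` p i] `<` [set` p j]
      & [set` p ord_max] = [set` P]].

(* Heights live in \bar int, so that they may be +oo; in particular the unit
   ideal, which is contained in no prime, has height +oo. *)
Definition prime_height (R : comPzRingType) (P : submodClosed R^o) : \bar int :=
  supremum 0%E [set (n%:Z)%:E | n in prime_chain P].

Definition height (R : comPzRingType) (I : submodClosed R^o) : \bar int :=
  infimum +oo%E
    [set prime_height P | P in
       [set P : submodClosed R^o | prime_ideal P /\ [set` I] `<=` [set` P]]].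

Definition minor_ideal (R : comPzRingType) (s r : nat) (A : 'M[R]_(s, r))
    (t : int) : set R :=
  if t <= 0 then setT else
  ideal_gen [set x | exists (g : 'I_`|t| -> 'I_s) (h : 'I_`|t| -> 'I_r),
    [/\ forall i j : 'I_`|t|, (i < j)%N -> (g i < g j)%N,
        forall i j : 'I_`|t|, (i < j)%N -> (h i < h j)%N
      & x = \det (mxsub g h A)]].

(* Exactness of R^s -> R^r -> M -> 0. Elements of free modules are row vectors,
   so A acts on the right and its rows are the relations. *)
Definition free_presentation (R : comPzRingType) (M : lmodType R) (s r : nat)
    (A : 'M[R]_(s, r)) (f : {linear 'rV[R]_r -> M}) : Prop :=
  range f = setT /\
  f @^-1` [set 0] = range (fun u : 'rV[R]_s => u *m A).

(* The ideal I_(r - j)(A) for a chosen finite free presentation of M; the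
   default value set0, which is not an ideal, is only taken when M has no finite
   free presentation. *)
Definition Fitt (R : comPzRingType) (M : lmodType R) (j : int) : set R :=
  xget set0 [set J | exists (s r : nat) (A : 'M[R]_(s, r))
    (f : {linear 'rV[R]_r -> M}),
    free_presentation A f /\ J = minor_ideal A (r%:Z - j)].

Record ideal_module (R : comPzRingType) (I : submodClosed R^o) : Type :=
  IdealModule { ideal_val : R^o; ideal_valP : ideal_val \in I }.

HB.instance Definition _ (R : comPzRingType) (I : submodClosed R^o) :=
  [isSub for @ideal_val R I].
HB.instance Definition _ (R : comPzRingType) (I : submodClosed R^o) :=
  [Choice of ideal_module I by <:].
HB.instance Definition _ (R : comPzRingType) (I : submodClosed R^o) :=
  [SubChoice_isSubLmodule of ideal_module I by <:].

(* Main.v *)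
Require Import Defs.
From HB Require Import structures.
From mathcomp Require Import all_boot all_order all_algebra perm.
From mathcomp Require Import boolp classical_sets cardinality constructive_ereal.

(** Both radicals are compared prime by prime: in a Noetherian ring an element
    lies in the radical of an ideal as soon as it lies in every prime above it.
    Fix a presentation of I by generators x_c, c < r, and a matrix A whose row
    space is the module of all their relations.

    A prime P above Fitt_j(I) contains I.  Outside V(I) the ideal is locally
    free of rank one, and a visible certificate of this is enough.  For a fixed c,
    the Koszul relations x_c e_k - x_k e_c are combinations of the rows of A, and
    for k running over r - j indices other than c (there are enough of them,
    since j >= 1) they form on those columns the scalar matrix x_c.  Expanding
    its determinant along the rows puts x_c ^ (r - j) in I_(r-j)(A)
    ([pres_minor_sub]).

    A prime P above I contains Fitt_j(I).  If a minor d of size r - j on columns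
    h is outside P, Cramer's rule shows that, for primes inside P, containing the
    j generators x_c with c outside h is the same as containing I
    ([minor_cramer]); so I is locally generated by j elements.  But every prime
    above I has height at least j + 1, and by the generalised principal ideal
    theorem a chain of length j + 1 ending at P can be traded for a chain of
    length one whose smaller prime contains these j elements, hence I.  This
    descent can be repeated for ever, whereas primes of a Noetherian ring have
    finite height ([pres_minor_in_prime]).

    The generalised principal ideal theorem [krull_height] is an exchange
    process: as long as a chain has a strict inclusion to spare, an element x of
    its top prime can be pushed into its bottom prime at the price of one step
    ([has_chain_exchange]).  A single exchange p0 < p1 < Q is the principal ideal
    theorem [krull_pit].  Localisations and quotients never appear as rings:
    working in R_Q / J is replaced by working with ideals J of R such that
    s a in J and s outside Q imply a in J. *)

Set Implicit Arguments.
Unset Strict Implicit.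
Unset Printing Implicit Defensive.

Import Order.TTheory GRing.Theory Num.Theory.
Local Open Scope classical_set_scope.
Local Open Scope ring_scope.

(** * Ideals and primes as sets *)

(** Sets, unlike the bundled submodules, can be compared by extensionality and
    built by classical comprehension. *)
Record is_ideal (R : comPzRingType) (J : set R) : Prop := IsIdeal {
  ideal0 : J 0;
  idealD : forall a b, J a -> J b -> J (a + b);
  idealM : forall c a, J a -> J (c * a) }.

Definition is_prime (R : comPzRingType) (P : set R) : Prop :=
  [/\ is_ideal P, ~ P 1 & forall a b, P (a * b) -> P a \/ P b].

Section IdealLemmas.
Context {R : comPzRingType}.
Implicit Types (J K P Q : set R) (a b c s x y z : R).

Lemma idealN J a : is_ideal J -> J a -> J (- a).
Proof. by move=> iJ Ja; rewrite -mulN1r; apply: idealM. Qed.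

Lemma idealB J a b : is_ideal J -> J a -> J b -> J (a - b).
Proof. by move=> iJ Ja Jb; apply: idealD => //; apply: idealN. Qed.

Lemma idealDr J a b : is_ideal J -> J b -> J (a + b) -> J a.
Proof. by move=> iJ Jb /idealB-/(_ b iJ Jb); rewrite addrK. Qed.

Lemma ideal_sum J (T : finType) (A : pred T) (F : T -> R) : is_ideal J ->
  (forall i, A i -> J (F i)) -> J (\sum_(i | A i) F i).
Proof.
by move=> iJ JF; elim/big_ind: _ => //; [exact: ideal0|exact: idealD].
Qed.

Lemma submod_is_ideal (J : submodClosed R^o) : is_ideal ([set` J] : set R).
Proof.
split; [exact: rpred0|by move=> a b; exact: rpredD|].
by move=> c a; exact: (@rpredZ _ R^o J c a).
Qed.

Lemma prime_idealP (P : submodClosed R^o) :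
  prime_ideal P -> is_prime ([set` P] : set R).
Proof.
move=> [P1 PM]; split; [exact: submod_is_ideal|exact/negP|].
by move=> a b /= /PM /orP.
Qed.

Definition ideal_pred J (iJ : is_ideal J) : {pred R^o} := fun a => `[< J a >].

Lemma ideal_pred_closed J (iJ : is_ideal J) :
  GRing.subsemimod_closed (ideal_pred iJ).
Proof.
split; first (split=> [|a b]).
- by apply/asboolP; exact: (ideal0 iJ).
- by move=> /asboolP Ja /asboolP Jb; apply/asboolP; exact: (idealD iJ).
- by move=> c a /asboolP Ja; apply/asboolP; exact: (idealM iJ).
Qed.

HB.instance Definition _ J (iJ : is_ideal J) :=
  GRing.isSubmodClosed.Build R R^o (ideal_pred iJ) (ideal_pred_closed iJ).

Definition ideal_submod J (iJ : is_ideal J) : submodClosed R^o :=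
  GRing.SubmodClosed.clone R R^o (ideal_pred iJ) _.

Lemma ideal_predE J (iJ : is_ideal J) : [set` ideal_submod iJ] = J.
Proof. by apply/seteqP; split=> a /asboolP. Qed.

Lemma ideal_submodP J (iJ : is_ideal J) :
  exists J' : submodClosed R^o, [set` J'] = J.
Proof. by exists (ideal_submod iJ); exact: ideal_predE. Qed.

Lemma prime_ideal_submodP P : is_prime P ->
  exists2 P' : submodClosed R^o, prime_ideal P' & [set` P'] = P.
Proof.
move=> [iP P1 PM]; exists (ideal_submod iP); last exact: ideal_predE.
split; first by apply/negP => /asboolP.
by move=> a b /asboolP /PM [] Pa; apply/orP; [left|right]; apply/asboolP.
Qed.

Lemma ideal_gen_sub (S : set R) J : is_ideal J -> S `<=` J -> ideal_gen S `<=` J.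
Proof.
move=> iJ SJ a ga; rewrite -(ideal_predE iJ); apply: ga.
by rewrite /= ideal_predE.
Qed.

Lemma sub_ideal_gen (S : set R) : S `<=` ideal_gen S.
Proof. by move=> a Sa J /= /(_ _ Sa). Qed.

Lemma ideal_gen_ideal (S : set R) : is_ideal (ideal_gen S).
Proof.
split=> [J _|a b ga gb J SJ|c a ga J SJ] /=; first exact: rpred0.
  by apply: rpredD; [exact: ga|exact: gb].
by apply: (@rpredZ _ R^o J c a); exact: ga.
Qed.

Lemma prime_exp P a n : is_prime P -> P (a ^+ n) -> P a.
Proof.
move=> [_ P1 PM]; elim: n => [|n IH]; first by rewrite expr0.
by rewrite exprS => /PM [].
Qed.

(** Dependent choice would otherwise give a strictly increasing sequence of
    ideals; a finite generating set of its union already lies in one term. *)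
Lemma noetherian_maximal (F : set (set R)) : noetherian R ->
  (forall J, F J -> is_ideal J) -> F !=set0 ->
  exists2 M, F M & forall N, F N -> M `<=` N -> N `<=` M.
Proof.
move=> nR iF [J0 FJ0]; apply: contrapT => noM.
have step J : exists N, F J -> [/\ F N, J `<=` N & ~ N `<=` J].
  have [FJ|nFJ] := pselect (F J); last by exists J.
  apply: contrapT => noN; apply: noM; exists J => // N FN JN.
  by apply: contrapT => nNJ; apply: noN; exists N.
have [next nextP] := choice step.
pose J n := iter n next J0.
have FJ n : F (J n) by elim: n => [//|n IH]; have [] := nextP _ IH.
have mono m n : (m <= n)%N -> J m `<=` J n.
  move=> /subnK <-; elim: (n - m)%N => [//|k IH].
  by apply: subset_trans IH _; have [] := nextP _ (FJ (k + m)%N).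
pose U a := exists n, J n a.
have iU : is_ideal U.
  split; first by exists 0%N; exact: (ideal0 (iF _ (FJ _))).
    move=> a b [m Jm] [n Jn]; exists (maxn m n); apply: (idealD (iF _ (FJ _))).
      by apply: mono Jm; exact: leq_maxl.
    by apply: mono Jn; exact: leq_maxr.
  by move=> c a [n Jn]; exists n; apply: idealM => //; exact: iF.
have [U' U'E] := ideal_submodP iU.
have [S finS SE] := nR U'.
have SU : S `<=` U by rewrite -U'E SE; exact: sub_ideal_gen.
have [n Sn] : exists n, S `<=` J n.
  have [s sE] := (finite_seqP S).1 finS.
  have: forall a, a \in s -> U a by move=> a as_; apply: SU; rewrite sE.
  rewrite sE; elim: s {sE} => [|a s IH] sU; first by exists 0%N.
  have [|n sn] := IH; first by move=> b bs; apply: sU; rewrite inE bs orbT.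
  have [|m Jm] := sU a; first by rewrite inE eqxx.
  exists (maxn m n) => b; rewrite /= inE => /orP [/eqP ->|bs].
    by apply: mono Jm; exact: leq_maxl.
  by apply: mono (sn _ bs); exact: leq_maxr.
have [_ _] := nextP _ (FJ n); apply; move=> a Ja.
apply: (ideal_gen_sub (iF _ (FJ n)) Sn); rewrite -SE U'E.
by exists n.+1.
Qed.

(** If no power of a is in J, an ideal maximal among those containing J and
    avoiding the powers of a is prime. *)
Lemma radical_prime J a : noetherian R -> is_ideal J ->
  (forall P, is_prime P -> J `<=` P -> P a) -> radical J a.
Proof.
move=> nR iJ Pa; apply: contrapT => nra.
pose F := [set K : set R | [/\ is_ideal K, J `<=` K & forall n, ~ K (a ^+ n)]].
have [|P [iP JP nP] maxP] := @noetherian_maximal F nR (fun K => fun '(And3 h _ _) => h).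
  by exists J; split=> // n Jn; apply: nra; exists n.
(* By maximality, P + (b) meets the powers of a as soon as b is outside P. *)
have ext b : ~ P b -> exists n c, P (a ^+ n - c * b).
  move=> nPb; apply: contrapT => nex.
  pose K x := exists c, P (x - c * b).
  apply: (nPb); apply: (maxP K).
  - split.
    + split.
      * by exists 0; rewrite mul0r subrr; exact: ideal0.
      * move=> x y [c Px] [d Py]; exists (c + d).
        by rewrite mulrDl opprD addrACA; exact: idealD.
      * move=> e x [c Px]; exists (e * c).
        by rewrite -mulrA -mulrBr; exact: idealM.
    + by move=> x Jx; exists 0; rewrite mul0r subr0; exact: JP.
    + by move=> n [c Pc]; apply: nex; exists n, c.
  - by move=> x Px; exists 0; rewrite mul0r subr0.
  - by exists 1; rewrite mul1r subrr; exact: ideal0.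
have := nP 1%N; apply; rewrite expr1; apply: Pa => //; split=> //.
  by have := nP 0%N; rewrite expr0.
move=> x y Pxy; apply: contrapT => /not_orP [/ext [m [c Pm]] /ext [n [d Pn]]].
have [] := nP (m + n)%N; rewrite exprD.
have -> : a ^+ m * a ^+ n = (a ^+ m - c * x) * a ^+ n
    + ((c * x) * (a ^+ n - d * y) + c * d * (x * y)).
  by rewrite mulrBl mulrBr (mulrACA c d) subrK subrK.
apply: idealD => //; first by rewrite mulrC; exact: idealM.
by apply: idealD => //; exact: idealM.
Qed.

(** * Ideals closed under localisation at a prime *)

(** The contraction to R of (J + (z)) R_Q. *)
Definition adjoin Q J z : set R := [set a | exists s r, ~ Q s /\ J (s * a + r * z)].

Section Adjoin.
Context {Q : set R} (pQ : is_prime Q).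

(** Contracted from R_Q, that is saturated with respect to the complement
    of Q. *)
Definition loc_closed J := forall s a, ~ Q s -> J (s * a) -> J a.

Lemma prime_notM s t : ~ Q s -> ~ Q t -> ~ Q (s * t).
Proof. by case: pQ => _ _ QM Qs Qt /QM []. Qed.

Lemma prime_not1 : ~ Q 1. Proof. by case: pQ. Qed.

Lemma adjoin_mono J K z : J `<=` K -> adjoin Q J z `<=` adjoin Q K z.
Proof. by move=> JK a [s [r [Qs Js]]]; exists s, r; split=> //; exact: JK. Qed.

Lemma adjoin_sub J z : is_ideal J -> J `<=` adjoin Q J z.
Proof.
move=> iJ a Ja; exists 1, 0; split; first exact: prime_not1.
by rewrite mul1r mul0r addr0.
Qed.

Lemma adjoin_mem J z : is_ideal J -> adjoin Q J z z.
Proof.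
move=> iJ; exists 1, (-1); split; first exact: prime_not1.
by rewrite mul1r mulN1r subrr; exact: ideal0.
Qed.

Lemma adjoin_ideal J z : is_ideal J -> is_ideal (adjoin Q J z).
Proof.
move=> iJ; split; first by apply: adjoin_sub => //; exact: ideal0.
- move=> a b [s [r [Qs Js]]] [t [q [Qt Jt]]].
  exists (s * t), (t * r + s * q); split; first exact: prime_notM.
  have -> : s * t * (a + b) + (t * r + s * q) * z
      = t * (s * a + r * z) + s * (t * b + q * z).
    rewrite !mulrDr !mulrDl !mulrA (mulrC t s) -!addrA; congr (_ + _).
    by rewrite addrCA.
  by apply: idealD => //; apply: idealM.
- move=> c a [s [r [Qs Js]]]; exists s, (c * r); split=> //.
  have -> : s * (c * a) + c * r * z = c * (s * a + r * z).
    by rewrite mulrDr !mulrA (mulrC s c).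
  exact: idealM.
Qed.

Lemma adjoin_closed J z : loc_closed (adjoin Q J z).
Proof.
move=> s a Qs [t [r [Qt Jt]]]; exists (t * s), r.
by split; [exact: prime_notM|rewrite -mulrA].
Qed.

(** The local ring R_Q / K R_Q has at most one prime, so it is Artinian.  Lengths
    are avoided by Noetherian induction on K: some z outside K is killed by Q
    modulo K, so K + (z) is a larger ideal of the same kind and adding z to a
    chain J loses at most one jump, at the moment when z leaves J. *)
Lemma local_dcc K (J : nat -> set R) : noetherian R ->
  is_ideal K -> loc_closed K ->
  (forall P, is_prime P -> K `<=` P -> P `<=` Q -> Q `<=` P) ->
  (forall n, is_ideal (J n)) -> (forall n, loc_closed (J n)) ->
  (forall n, K `<=` J n) -> (forall n, J n.+1 `<=` J n) ->
  exists n, J n `<=` J n.+1.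
Proof.
move=> nR iK cK minK iJ cJ KJ decJ.
pose bad K := [/\ is_ideal K, loc_closed K,
  forall P, is_prime P -> K `<=` P -> P `<=` Q -> Q `<=` P &
  exists J : nat -> set R, [/\ forall n, is_ideal (J n) /\ loc_closed (J n),
    forall n, K `<=` J n, forall n, J n.+1 `<=` J n
    & forall n, ~ J n `<=` J n.+1]].
apply: contrapT => nstab.
have : bad K.
  split=> //; exists J; split=> // n Jn; apply: nstab; by exists n.
move=> badK; have {K J iK cK minK iJ cJ KJ decJ nstab badK} :=
  @noetherian_maximal bad nR (fun K => fun '(And4 h _ _ _) => h) (ex_intro _ K badK).
move=> [K [iK cK minK [J [iJ KJ decJ nstab]]] maxK].
have nK1 : ~ K 1.
  move=> K1; apply: (nstab 0%N) => a _; apply: KJ.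
  by rewrite -(mulr1 a); exact: idealM.
(* An annihilator (K : z) that is maximal, with z outside K, is a prime between
   K and Q, hence it is Q. *)
have [z nKz zQ] : exists2 z, ~ K z & forall r, Q r -> K (r * z).
  pose G := [set L | is_ideal L /\ exists2 w, ~ K w & L = [set r | K (r * w)]].
  have iG w : is_ideal [set r | K (r * w)].
    split=> /=; first by rewrite mul0r; exact: ideal0.
      by move=> a b Ka Kb; rewrite mulrDl; exact: idealD.
    by move=> c a Ka; rewrite -mulrA; exact: idealM.
  have [|L [_ [z nKz LE]] maxL] := @noetherian_maximal G nR (fun K => fun '(conj h _) => h).
    by exists [set r | K (r * 1)]; split; [exact: iG|exists 1].
  exists z => //; suff : Q `<=` L by move=> QL r /QL; rewrite LE.
  rewrite {}LE in maxL *; apply: minK.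
  - split; [exact: iG|by rewrite /= mul1r|].
    move=> a b /= Kab; have [Ka|nKa] := pselect (K (a * z)); [by left|right].
    apply: (maxL [set r | K (r * (a * z))]) => /=.
    + by split; [exact: iG|exists (a * z)].
    + by move=> r /= Kr; rewrite mulrCA; exact: idealM.
    + by rewrite mulrA (mulrC b).
  - by move=> r Kr /=; rewrite mulrC; exact: idealM.
  - move=> r /= Krz; apply: contrapT => nQr; exact: nKz (cK _ _ nQr Krz).
(* From rank m on, membership of z in J n no longer changes. *)
have [m mP] : exists m, (forall n, J n z) \/ (forall n, (m <= n)%N -> ~ J n z).
  have [?|/existsNP [m Jm]] := pselect (forall n, J n z); first by exists 0%N; left.
  exists m; right => n mn Jn; apply: Jm; move: Jn; rewrite -(subnK mn).
  by elim: (n - m)%N => [//|k IH] /decJ.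
suff bad' : bad (adjoin Q K z).
  apply/nKz/(maxK _ bad'); first exact: adjoin_sub.
  exact: adjoin_mem.
split; [exact: adjoin_ideal|exact: adjoin_closed| |].
  move=> P pP KP; apply: minK => //; apply: subset_trans KP; exact: adjoin_sub.
exists (fun n => adjoin Q (J (n + m)%N) z); split.
- by move=> n; split; [apply: adjoin_ideal; case: (iJ (n + m)%N)|exact: adjoin_closed].
- by move=> n; exact: adjoin_mono.
- by move=> n; apply: adjoin_mono; rewrite addSn.
move=> n; rewrite addSn => Jz; apply: (nstab (n + m)%N) => a Ja.
have [iJn cJn] := iJ (n + m)%N; have [iJn1 cJn1] := iJ (n + m).+1.
have [|s [r [nQs Js]]] := Jz a; first exact: adjoin_sub.
apply: (cJn1 s) => //; apply: (idealDr _ _ Js) => //.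
case: mP => [Jz'|nJz]; first exact: idealM.
apply: KJ; apply: zQ; apply: contrapT => nQr.
apply: (nJz (n + m)%N); first exact: leq_addl.
apply: (cJn r) => //.
apply: (@idealDr _ _ (s * a) iJn); first exact: idealM.
by rewrite addrC; exact: decJ.
Qed.

(** Nakayama's lemma for K contained in K' + x K in R_Q.  Replace K' by a maximal
    closed ideal L above it that does not contain K.  For g in K outside L, K
    is generated by g modulo L, and the hypothesis gives (u - x r) g in L with u
    a unit of R_Q. *)
Lemma local_nakayama K K' x : noetherian R ->
  is_ideal K -> is_ideal K' -> loc_closed K' -> Q x ->
  (forall a, K a -> exists s b, [/\ ~ Q s, K b & K' (s * a + x * b)]) ->
  K `<=` K'.
Proof.
move=> nR iK iK' cK' Qx KxK; apply: contrapT => nKK'.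
pose F := [set L | [/\ is_ideal L, loc_closed L, K' `<=` L & ~ K `<=` L]].
have [|L [iL cL K'L nKL] maxL] :=
  @noetherian_maximal F nR (fun K => fun '(And4 h _ _ _) => h).
  by exists K'; split.
apply: (nKL) => g Kg; apply: contrapT => nLg.
have KLg : K `<=` adjoin Q L g.
  apply: contrapT => nK; apply: (nLg); apply: (maxL (adjoin Q L g)).
  - split=> //; [exact: adjoin_ideal|exact: adjoin_closed|].
    by apply: subset_trans K'L _; exact: adjoin_sub.
  - exact: adjoin_sub.
  - exact: adjoin_mem.
have [s [b [nQs Kb Ks]]] := KxK _ Kg.
have [t [r [nQt Lt]]] := KLg _ Kb.
apply/nLg/(cL (t * s - x * r)).
  case: (pQ) => iQ _ _ Qts; apply: (prime_notM nQt nQs).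
  rewrite -(subrK (x * r) (t * s)); apply: idealD => //.
  by rewrite mulrC; exact: idealM.
have -> : (t * s - x * r) * g = t * (s * g + x * b) - x * (t * b + r * g).
  rewrite mulrBl !mulrDr opprD addrA !mulrA (mulrC t x); congr (_ - _).
  by rewrite addrK.
by apply: idealB => //; apply: idealM => //; exact: K'L.
Qed.

End Adjoin.

(** * Krull's height theorem *)

(** The principal ideal theorem in R / p0: if Q is minimal over p0 + (x), no
    prime fits strictly between p0 and Q.  Take y in p1 outside p0 and let K n be
    the contraction to R of (y ^ n) in (R / p0)_p1.  The chain K n + (x)
    stabilises by [local_dcc]; as x is a unit at p1, this reads
    K n = K n.+1 + x K n in R_Q, so K n = K n.+1 by Nakayama.  Then y ^ n is a
    multiple of y ^ n.+1 in (R / p0)_p1, a domain where y is a nonzero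
    non-unit. *)
Lemma krull_pit p0 p1 Q x : noetherian R ->
  is_prime p0 -> is_prime p1 -> is_prime Q ->
  p0 `<` p1 -> p1 `<` Q -> Q x ->
  ~ (forall P, is_prime P -> p0 `<=` P -> P x -> P `<=` Q -> Q `<=` P).
Proof.
move=> nR pp0 pp1 pQ [p01 np10] [p1Q nQp1] Qx minQ.
have [i0 _ p0M] := pp0; have [i1 _ _] := pp1.
have np1x : ~ p1 x by move=> p1x; apply: nQp1; apply: minQ.
have /existsNP [y /not_implyP [p1y np0y]] := np10.
pose K n := adjoin p1 p0 (y ^+ n).
have iK n : is_ideal (K n) by exact: adjoin_ideal.
have cK n s a : ~ p1 s -> K n (s * a) -> K n a.
  exact: (adjoin_closed pp1).
have Kdec n : K n.+1 `<=` K n.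
  move=> a [s [r [ns Ks]]]; exists s, (r * y); split=> //.
  by rewrite -mulrA -exprS.
have [] := @local_dcc Q pQ (adjoin Q p0 x) (fun n => adjoin Q (K n) x) nR.
- exact: adjoin_ideal.
- exact: adjoin_closed.
- move=> P pP KP; apply: minQ => //.
    by apply: subset_trans KP; exact: adjoin_sub.
  by apply: KP; exact: adjoin_mem.
- by move=> n; exact: adjoin_ideal.
- by move=> n; exact: adjoin_closed.
- by move=> n; apply: adjoin_mono; exact: adjoin_sub.
- by move=> n; exact: adjoin_mono.
move=> n Jn.
have KK : K n `<=` K n.+1.
  apply: (@local_nakayama Q pQ _ _ x nR (iK n) (iK n.+1)) => //.
    by move=> s a nQs; apply: cK => /p1Q.
  move=> a Ka; have [|s [r [nQs Ks]]] := Jn a; first exact: adjoin_sub.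
  exists s, r; split=> //; last by rewrite (mulrC x).
  apply: (cK n x) => //; rewrite mulrC.
  apply: (@idealDr _ _ (s * a) (iK n)); first exact: idealM.
  by rewrite addrC; exact: Kdec.
have [|s [r [nps ps]]] := KK (y ^+ n); first exact: adjoin_mem.
move: ps; rewrite exprS mulrA -mulrDl => /p0M [/p01 p1sy|/prime_exp h].
  apply: nps; apply: (idealDr i1 _ p1sy); exact: idealM.
by apply: np0y; exact: h.
Qed.

(** A chain of n strict inclusions of primes that starts above S and ends at P;
    the recursive form lets the exchange argument walk down from the top. *)
Fixpoint has_chain (S : set R) n P : Prop :=
  is_prime P /\ if n is n'.+1 then exists2 p, p `<` P & has_chain S n' p
                else S `<=` P.

Lemma has_chain_prime S n P : has_chain S n P -> is_prime P.
Proof. by case: n => [|n] []. Qed.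

(** Going down the chain, x is forced into one prime after another: given
    p0 < p1 < Q with x in Q, the principal ideal theorem lets p1 be replaced by
    a prime containing x.  The bottom prime is given up at the end. *)
Lemma has_chain_exchange (S : set R) n Q x : noetherian R -> Q x ->
  has_chain S n.+1 Q -> has_chain (S `|` [set x]) n Q.
Proof.
move=> nR; elim: n Q => [|n IH] Q Qx [pQ [p1 p1Q]].
  by move=> [pp1 Sp1]; split=> // a [/Sp1|->] //; apply: p1Q.1.
move=> [pp1 [p0 p01 cp0]]; split=> //.
have [p' [pp' p0p' p'Q p'x]] : exists p, [/\ is_prime p, p0 `<` p, p `<` Q & p x].
  have [p1x|np1x] := pselect (p1 x); first by exists p1.
  apply: contrapT => nop.
  apply: (krull_pit nR (has_chain_prime cp0) pp1 pQ p01 p1Q Qx).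
  move=> P pP p0P Px PQ; apply: contrapT => nQP; apply: nop; exists P; split=> //.
  by split=> // Pp0; apply/np1x/p01.1/Pp0.
exists p' => //; apply: IH => //=.
by split=> //; exists p0.
Qed.

(** With n = 1 this is the classical statement in contrapositive form: a prime
    minimal over S and m elements ends no chain of length m + 1 above S. *)
Lemma krull_height (S : set R) (xs : seq R) n Q : noetherian R ->
  {in xs, forall x, Q x} -> has_chain S (size xs + n) Q ->
  has_chain (S `|` [set` xs]) n Q.
Proof.
move=> nR; elim: xs S => [|x xs IH] S xsQ.
  by rewrite set_nil setU0.
rewrite -[size _]/(size xs).+1 addSn => cQ.
have -> : [set` x :: xs] = [set x] `|` [set` xs].
  apply/seteqP; split=> a /=; rewrite inE.
    by move=> /orP [/eqP ->|axs]; [left|right].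
  by move=> [->|->]; rewrite ?eqxx ?orbT.
rewrite setUA; apply: IH.
  by move=> a as_; apply: xsQ; rewrite inE as_ orbT.
by apply: has_chain_exchange cQ => //; apply: xsQ; rewrite inE eqxx.
Qed.

Lemma ideal_fin_gen J : noetherian R -> is_ideal J ->
  exists xs : seq R, J = ideal_gen [set` xs].
Proof.
move=> nR /ideal_submodP [J' <-]; have [S /finite_seqP [xs ->] ->] := nR J'.
by exists xs.
Qed.

(** Q is trivially minimal over its own finite set of generators. *)
Lemma prime_finite_height (S : set R) Q : noetherian R -> is_prime Q ->
  exists n, ~ has_chain S n Q.
Proof.
move=> nR pQ; have [iQ _ _] := pQ; have [xs QE] := ideal_fin_gen nR iQ.
have xsQ : [set` xs] `<=` Q by rewrite QE; exact: sub_ideal_gen.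
exists (size xs + 1)%N => /krull_height-/(_ nR xsQ) [_ [p [_ nQp] [[ip _ _] Sxp]]].
apply: nQp; rewrite QE; apply: ideal_gen_sub => // x xsx.
by apply: Sxp; right.
Qed.

End IdealLemmas.

(** * Minors *)

Section Minors.
Context {R : comPzRingType}.
Implicit Types (J P : set R).

Definition increasing s t (g : 'I_t -> 'I_s) :=
  forall i j : 'I_t, (i < j)%N -> (g i < g j)%N.

Lemma increasing_inj s t (g : 'I_t -> 'I_s) : increasing g -> injective g.
Proof.
move=> incg i j gij; apply/val_inj; case: (ltngtP i j) => // /incg.
  by rewrite gij ltnn.
by rewrite gij ltnn.
Qed.

Lemma increasing_perm s t (g : 'I_t -> 'I_s) : injective g ->
  exists p : 'S_t, increasing (g \o p).
Proof.
move=> injg; pose T := [tuple g i | i < t].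
pose le := fun a b : 'I_s => (a <= b)%N.
have le_tr : transitive le by move=> b a c; exact: leq_trans.
have /tuple_permP [p pE] : perm_eq (sort le T) T by rewrite perm_sort.
exists p => i j ij.
have gpE k : g (p k) = nth (g i) (sort le T) k.
  by rewrite pE -tnth_nth !tnth_mktuple.
rewrite /= ltn_neqAle; apply/andP; split.
  apply/negP => /eqP/val_inj/injg/perm_inj ijE.
  by rewrite ijE ltnn in ij.
rewrite !gpE; have /(sorted_leq_nth le_tr) : sorted le (sort le T).
  by apply: sort_sorted => a b; exact: leq_total.
move=> /(_ (fun a => leqnn a) (g i)); apply; last exact: ltnW.
- by rewrite inE size_sort size_tuple.
- by rewrite inE size_sort size_tuple.
Qed.

(** The ideal I_t(A) is generated by minors with increasing row indices; other
    choices of rows give the same minors up to sign, or zero. *)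
Lemma minor_rows J s r t (A : 'M[R]_(s, r)) (g : 'I_t -> 'I_s) (h : 'I_t -> 'I_r) :
  is_ideal J -> (forall g', increasing g' -> J (\det (mxsub g' h A))) ->
  J (\det (mxsub g h A)).
Proof.
move=> iJ incJ; have [injg|/injectivePn [i [k ik gik]]] := altP (injectiveP g).
  have [p incp] := increasing_perm injg.
  have -> : \det (mxsub g h A) = (-1) ^+ p * \det (mxsub (g \o p) h A).
    have -> : mxsub (g \o p) h A = row_perm p (mxsub g h A).
      by apply/matrixP => a b; rewrite !mxE.
    by rewrite row_permE det_mulmx det_perm mulrA -exprD addnn -mul2n exprM
       sqrrN !expr1n mul1r.
  by apply: idealM => //; exact: incJ.
rewrite (determinant_alternate ik); first exact: ideal0.
by move=> l; rewrite !mxE gik.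
Qed.

(** Multilinearity in the rows: det (C B) is a combination of the maximal minors
    of B, as in the Cauchy-Binet formula before like terms are collected. *)
Lemma det_mul_ideal J s t (C : 'M[R]_(t, s)) (B : 'M[R]_(s, t)) : is_ideal J ->
  (forall g : 'I_t -> 'I_s, J (\det (rowsub g B))) -> J (\det (C *m B)).
Proof.
move=> iJ JB.
have -> : \det (C *m B) = \sum_(g : {ffun 'I_t -> 'I_s})
    (\prod_i C i (g i)) * \det (rowsub g B).
  transitivity (\sum_(g : {ffun 'I_t -> 'I_s}) \sum_(p : 'S_t)
      (-1) ^+ p * \prod_i (C i (g i) * B (g i) (p i))).
    rewrite exchange_big; apply: eq_bigr => /= p _; rewrite -big_distrr /=.
    rewrite -(bigA_distr_bigA (fun i k => C i k * B k (p i))) /=.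
    by congr (_ * _); apply: eq_bigr => i _; rewrite mxE.
  apply: eq_bigr => g _; rewrite big_distrr; apply: eq_bigr => p _ /=.
  rewrite big_split mulrCA; congr (_ * (_ * _)).
  by apply: eq_bigr => i _; rewrite mxE.
by apply: ideal_sum => // g _; exact: idealM.
Qed.

(** Cramer's rule: modulo the coordinates of x outside h, the relations on the
    rows g say that N x_h = 0 for a square block N with determinant outside P. *)
Lemma minor_cramer P s r t (A : 'M[R]_(s, r)) (x : 'cV[R]_r)
    (g : 'I_t -> 'I_s) (h : 'I_t -> 'I_r) : is_prime P -> injective h ->
  A *m x = 0 -> ~ P (\det (mxsub g h A)) ->
  (forall c, c \notin codom h -> P (x c 0)) -> forall c, P (x c 0).
Proof.
move=> pP injh Ax nPd Px c; have [iP _ PM] := pP.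
have [/codomP [k ->]|/Px //] := boolP (c \in codom h).
set N := mxsub g h A; pose y := \col_l x (h l) 0.
have PNy i : P ((N *m y) i 0).
  have : (A *m x) (g i) 0 = 0 by rewrite Ax mxE.
  rewrite mxE (bigID (fun c => c \in codom h)) /=.
  have -> : \sum_(c | c \in codom h) A (g i) c * x c 0 = (N *m y) i 0.
    rewrite -big_uniq /=; last by rewrite map_inj_uniq ?enum_uniq.
    by rewrite big_image mxE; apply: eq_bigr => l _; rewrite !mxE.
  move/eqP; rewrite addr_eq0 => /eqP ->; apply: idealN => //.
  by apply: ideal_sum => // d /Px; exact: idealM.
have : P ((\adj N *m (N *m y)) k 0).
  by rewrite mxE; apply: ideal_sum => // i _; exact: idealM.
by rewrite mulmxA mul_adj_mx mul_scalar_mx !mxE => /PM [].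
Qed.

End Minors.

(** * Presentations of ideals *)

Section Presentations.
Context {R : comPzRingType}.
Implicit Types (J P : set R).

(** The data of a free presentation of J, with the surjection replaced by the
    column of its values on the canonical basis. *)
Record is_presentation J s r (x : 'cV[R]_r) (A : 'M[R]_(s, r)) : Prop := {
  pres_gen : forall a, J a <-> exists u : 'rV_r, u *m x = a%:M;
  pres_rel : A *m x = 0;
  pres_syz : forall u : 'rV_r, u *m x = 0 -> exists w : 'rV_s, u = w *m A }.

Lemma pres_mem J s r x (A : 'M[R]_(s, r)) c : is_presentation J x A -> J (x c 0).
Proof.
move=> [gen _ _]; apply/gen; exists (delta_mx 0 c).
by rewrite -rowE; apply/matrixP => i j; rewrite !ord1 !mxE eqxx.
Qed.

Lemma pres_sub_ideal J s r x (A : 'M[R]_(s, r)) P :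
  is_presentation J x A -> is_ideal P -> (forall c, P (x c 0)) -> J `<=` P.
Proof.
move=> [gen _ _] iP Px a /gen [u /matrixP /(_ 0 0)]; rewrite !mxE eqxx mulr1n => <-.
by apply: ideal_sum => // c _; exact: idealM.
Qed.

(** For each c, the relations x_c e_(h k) - x_(h k) e_c, where h avoids c,
    restrict to the scalar matrix x_c on the columns h; so x_c ^ t is a
    combination of t-minors of A. *)
Lemma pres_minor_sub J s r x (A : 'M[R]_(s, r)) t P :
  is_presentation J x A -> (t < r)%N -> is_prime P ->
  (forall (g : 'I_t -> 'I_s) (h : 'I_t -> 'I_r), increasing g -> increasing h ->
     P (\det (mxsub g h A))) -> J `<=` P.
Proof.
move=> pres tr pP Pminor; have [iP _ _] := pP.
apply: (pres_sub_ideal pres) => // c.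
case: r => [|r] in x A pres tr Pminor c *; first by case: c.
pose h k : 'I_r.+1 := lift c (widen_ord (tr : t <= r)%N k).
have inch : increasing h.
  by move=> i j ij; rewrite /= ltnNge leq_bump2 -ltnNge.
pose u k := x c 0 *: delta_mx 0 (h k) - x (h k) 0 *: delta_mx 0 c : 'rV[R]_r.+1.
have ux k : u k *m x = 0.
  rewrite mulmxBl -!scalemxAl -!rowE; apply/matrixP => i j.
  by rewrite !ord1 !mxE mulrC subrr.
have /choice [w wE] k : exists w, u k = w *m A by exact: (pres_syz pres (ux k)).
apply: (@prime_exp _ P _ t pP).
have <- : \det (\matrix_k w k *m colsub h A) = x c 0 ^+ t.
  have -> : \matrix_k w k *m colsub h A = (x c 0)%:M.
    apply/matrixP => k l.
    have -> : (\matrix_k w k *m colsub h A) k l = (w k *m A) 0 (h l).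
      by rewrite !mxE; apply: eq_bigr => i _; rewrite !mxE.
    rewrite -wE !mxE !eqxx /= (inj_eq (increasing_inj inch)).
    by rewrite (eq_sym _ c) (negPf (neq_lift _ _)) mulr0 subr0 mulr_natr eq_sym.
  by rewrite det_scalar.
apply: det_mul_ideal => // g.
have -> : rowsub g (colsub h A) = mxsub g h A.
  by apply/matrixP => i j; rewrite !mxE.
by apply: minor_rows => // g' incg'; exact: Pminor.
Qed.

Lemma ideal_fin_gen_mx J : noetherian R -> is_ideal J ->
  exists n (x : 'cV[R]_n), forall a, J a <-> exists u : 'rV_n, u *m x = a%:M.
Proof.
move=> nR iJ; have [xs JE] := ideal_fin_gen nR iJ.
exists (size xs), (\col_i nth 0 xs i) => a; split; last first.
  move=> [u /matrixP /(_ 0 0)]; rewrite !mxE eqxx mulr1n => <-.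
  apply: ideal_sum => // i _; rewrite mxE; apply: idealM => //.
  by rewrite JE; apply: sub_ideal_gen => /=; exact: mem_nth.
rewrite JE; pose K a := exists u, u *m (\col_(i < size xs) nth 0 xs i) = a%:M.
apply: (@ideal_gen_sub _ _ K) => [|b /= /(nthP 0) [i ltis <-]].
  split.
  - by exists 0; rewrite mul0mx raddf0.
  - by move=> b c [u uE] [v vE]; exists (u + v); rewrite mulmxDl uE vE raddfD.
  - move=> c b [u uE]; exists (c *: u).
    by rewrite -scalemxAl uE scale_scalar_mx.
exists (delta_mx 0 (Ordinal ltis)); rewrite -rowE.
by apply/matrixP => j k; rewrite !ord1 !mxE eqxx mulr1n.
Qed.

(** Induction on r: a submodule K of R^(1+r) is an extension of the ideal J of
    first coordinates by the submodule of vectors whose first coordinate is 0. *)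
Lemma noetherian_submodule r (K : set 'rV[R]_r) : noetherian R -> K 0 ->
  (forall u v, K u -> K v -> K (u + v)) -> (forall a u, K u -> K (a *: u)) ->
  exists s (A : 'M[R]_(s, r)), K = range (fun u : 'rV_s => u *m A).
Proof.
move=> nR; elim: r K => [|r IH] K K0 KD KZ.
  exists 0%N, 0; apply/seteqP; split=> u _; first by exists 0 => //; rewrite !thinmx0.
  by rewrite [u]thinmx0.
rewrite -[r.+1]/(1 + r)%N in K K0 KD KZ *.
pose J a := exists w : 'rV_r, K (row_mx a%:M w).
have iJ : is_ideal J.
  split.
  - by exists 0; rewrite raddf0 row_mx0.
  - move=> a b [v Kv] [w Kw]; exists (v + w).
    by rewrite raddfD -add_row_mx; exact: KD.
  - move=> c a [v Kv]; exists (c *: v).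
    by rewrite -scale_scalar_mx -scale_row_mx; exact: KZ.
have [n [x xE]] := ideal_fin_gen_mx nR iJ.
have /choice [w wK] i : J (x i 0).
  apply/xE; exists (delta_mx 0 i); rewrite -rowE.
  by apply/matrixP => j k; rewrite !ord1 !mxE eqxx mulr1n.
pose L := row_mx x (\matrix_i w i).
have KL (u : 'rV_n) : K (u *m L).
  rewrite mulmx_sum_row; elim/big_ind: _ => // i _; apply: KZ.
  have -> : row i L = row_mx (x i 0)%:M (w i) => //.
  by rewrite row_row_mx rowK; congr row_mx; apply/matrixP => j k; rewrite !ord1 !mxE.
have [|||s [A' A'E]] := IH [set v | K (row_mx 0 v)].
- by rewrite /= row_mx0.
- by move=> u v Ku Kv /=; rewrite -[0]addr0 -add_row_mx; exact: KD.
- by move=> a u Ku /=; rewrite -(scaler0 _ a) -scale_row_mx; exact: KZ.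
exists (n + s)%N, (col_mx L (row_mx 0 A')); apply/seteqP; split=> [v Kv|_ [u _ <-]].
  have : J (v 0 0).
    exists (rsubmx v); congr (K _): Kv; rewrite -{1}(hsubmxK v); congr row_mx.
    by apply/matrixP => i j; rewrite !ord1 !mxE; congr (v _ _); apply: val_inj.
  move=> /xE [u uE].
  have vE : v - u *m L = row_mx 0 (rsubmx (v - u *m L)).
    rewrite -{1}(hsubmxK (v - u *m L)); congr row_mx.
    rewrite raddfB /= mul_mx_row row_mxKl uE; apply/matrixP => i j.
    rewrite !ord1 !mxE eqxx mulr1n; apply/eqP; rewrite subr_eq0; apply/eqP.
    by congr (v _ _); apply: val_inj.
  have : [set v | K (row_mx 0 v)] (rsubmx (v - u *m L)).
    by rewrite /= -vE -scaleN1r; apply: KD => //; exact: KZ.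
  rewrite A'E => -[u' _ u'E]; exists (row_mx u u') => //=.
  by rewrite mul_row_col (mul_mx_row u') mulmx0 u'E -vE addrC subrK.
rewrite -(hsubmxK u) mul_row_col (mul_mx_row (rsubmx u)) mulmx0.
apply: KD => //; rewrite -[K _]/([set v | K (row_mx 0 v)] _) A'E.
by exists (rsubmx u).
Qed.

Lemma presentation_exists J : noetherian R -> is_ideal J ->
  exists s r (x : 'cV[R]_r) (A : 'M[R]_(s, r)), is_presentation J x A.
Proof.
move=> nR /(ideal_fin_gen_mx nR) [r [x xE]].
have [|||s [A AE]] := @noetherian_submodule r [set u | u *m x = 0] nR.
- by rewrite /= mul0mx.
- by move=> u v /= ux vx; rewrite mulmxDl ux vx addr0.
- by move=> a u /= ux; rewrite -scalemxAl ux scaler0.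
exists s, r, x, A; split=> //.
  apply/row_matrixP => i; rewrite row_mul row0 rowE.
  suff : range (fun u : 'rV_s => u *m A) (delta_mx 0 i *m A) by rewrite -AE.
  by exists (delta_mx 0 i).
move=> u ux; have : [set u | u *m x = 0] u by [].
by rewrite AE => -[w _ <-]; exists w.
Qed.

Section FreePresentation.
Context {I : submodClosed R^o}.

Lemma ideal_valD (a b : ideal_module I) :
  ideal_val (a + b) = ideal_val a + ideal_val b.
Proof. exact: (raddfD (val : ideal_module I -> R^o)). Qed.

Lemma ideal_val0 : ideal_val (0 : ideal_module I) = 0.
Proof. exact: (@raddf0 _ _ (val : ideal_module I -> R^o)). Qed.

Lemma ideal_valZ c (a : ideal_module I) :
  ideal_val (c *: a) = c * ideal_val a :> R.
Proof. exact: (@GRing.valZ R R^o _ (ideal_module I) c a). Qed.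

Lemma free_presentationP s r (A : 'M[R]_(s, r))
    (f : {linear 'rV[R]_r -> ideal_module I}) : free_presentation A f ->
  is_presentation [set` I] (\col_c (ideal_val (f (delta_mx 0 c)) : R)) A.
Proof.
set x := \col_c _; move=> [surj ker].
have fE u : u *m x = (ideal_val (f u) : R)%:M.
  apply/matrixP => i j; rewrite !ord1 !mxE eqxx mulr1n.
  rewrite [in RHS](row_sum_delta u) linear_sum (big_morph _ ideal_valD ideal_val0).
  by apply: eq_bigr => c _; rewrite linearZ ideal_valZ mxE.
have kerP u : u *m x = 0 <-> range (fun w : 'rV_s => w *m A) u.
  rewrite fE -ker; split=> [/matrixP /(_ 0 0)|/= ->].
    by rewrite !mxE mulr1n => fu0; apply: val_inj; rewrite [LHS]fu0 [RHS]ideal_val0.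
  by rewrite ideal_val0 raddf0.
split=> [a||u /kerP [w _ <-]]; last by exists w.
- split=> [Ia|[u]].
    have : range f (IdealModule (Ia : (a : R^o) \in I)) by rewrite surj.
    by move=> [u _ fu]; exists u; rewrite fE fu.
  rewrite fE => /matrixP /(_ 0 0); rewrite !mxE !mulr1n => <-.
  exact: ideal_valP.
- apply/row_matrixP => i; rewrite row_mul row0 rowE; apply/kerP.
  by exists (delta_mx 0 i).
Qed.

Section GeneratorMap.
Context {r : nat} {x : 'cV[R]_r}
  (xI : forall u : 'rV_r, ((u *m x) 0 0 : R^o) \in I).

Definition gen_map (u : 'rV[R]_r) : ideal_module I := IdealModule (xI u).

Lemma gen_map_linear : linear gen_map.
Proof.
move=> a u v; apply: val_inj; rewrite [RHS]ideal_valD ideal_valZ /=.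
by rewrite mulmxDl -scalemxAl !mxE.
Qed.

HB.instance Definition _ :=
  GRing.isLinear.Build R 'rV[R]_r (ideal_module I) _ gen_map gen_map_linear.

Lemma gen_map_presentation s (A : 'M[R]_(s, r)) :
  is_presentation [set` I] x A -> free_presentation A gen_map.
Proof.
move=> [gen rel syz]; split; apply/seteqP; split=> //.
- move=> a _; have /gen [u uE] : [set` I] (ideal_val a : R) by exact: ideal_valP.
  by exists u => //; apply: val_inj; rewrite /= uE mxE eqxx mulr1n.
- move=> u /= fu0; have [|w ->] := syz u; last by exists w.
  apply/matrixP => i j; rewrite !ord1 [RHS]mxE.
  by rewrite -ideal_val0 -fu0.
- move=> _ [w _ <-]; apply: val_inj; rewrite [RHS]ideal_val0 /=.
  by rewrite -mulmxA rel mulmx0 mxE.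
Qed.

End GeneratorMap.

(** The Fitting ideal is defined by a choice of presentation, so one must exist;
    the rest of the proof applies to whichever was chosen. *)
Lemma Fitt_presentation j : noetherian R ->
  exists s r (x : 'cV[R]_r) (A : 'M[R]_(s, r)),
    is_presentation [set` I] x A /\
    Fitt (ideal_module I) j = minor_ideal A (r%:Z - j).
Proof.
move=> nR; rewrite /Fitt; case: xgetP => [_ -> [s [r [A [f [fA ->]]]]]|none].
  by exists s, r, (\col_c ideal_val (f (delta_mx 0 c))), A; split=> //;
    exact: free_presentationP.
have [s [r [x [A pA]]]] := presentation_exists nR (submod_is_ideal I).
have xI (u : 'rV_r) : ((u *m x) 0 0 : R^o) \in I.
  have [gen _ _] := pA; apply/gen; exists u.
  by apply/matrixP => i k; rewrite !ord1 [RHS]mxE eqxx mulr1n.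
exfalso; apply: (none (minor_ideal A (r%:Z - j))); exists s, r, A.
by exists (gen_map xI); split=> //; exact: gen_map_presentation.
Qed.

End FreePresentation.
End Presentations.

(** * Heights of ideals *)

Section Heights.
Context {R : comPzRingType}.
Implicit Types (P Q : submodClosed R^o).

Lemma prime_chain_has_chain P n k : prime_chain P n -> (k <= n)%N ->
  has_chain set0 k ([set` P] : set R).
Proof.
move=> [p [pp plt <-]] kn.
have chain (i : 'I_n.+1) : (k <= i)%N -> has_chain set0 k ([set` p i] : set R).
  elim: k {kn} i => [|k IH] i ki; first by split; [exact: prime_idealP|].
  split; first exact: prime_idealP.
  have lti : (i.-1 < n.+1)%N by apply: leq_ltn_trans (leq_pred _) (ltn_ord i).
  exists [set` p (Ordinal lti)].
    by apply: plt => /=; rewrite prednK //; exact: leq_ltn_trans ki.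
  by apply: IH => /=; rewrite -ltnS prednK //; exact: leq_ltn_trans ki.
exact: chain.
Qed.

Lemma prime_chain0 P : prime_ideal P -> prime_chain P 0.
Proof.
by move=> pP; exists (fun=> P); split=> // i j; rewrite !ord1.
Qed.

(** The supremum defining the height exists: it is a maximum when the lengths
    are bounded, and +oo otherwise. *)
Lemma prime_height_cases P : prime_ideal P ->
  (exists2 n, prime_height P = (n%:Z)%:E & prime_chain P n) \/
  (prime_height P = +oo%E /\ forall m, exists2 n, prime_chain P n & (m <= n)%N).
Proof.
move=> pP; rewrite /prime_height; set S := [set _ | _ in _].
have S0 : S (0%:Z)%:E by exists 0%N => //; exact: prime_chain0.
have nS0 : (S == set0) = false by apply/negP => /eqP S0E; rewrite S0E in S0.
rewrite /supremum nS0.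
have supE y : supremums S y -> xget 0%E (supremums S) = y.
  by move=> Sy; apply: (is_subset1_supremums _ Sy); exact: xgetI Sy.
have [[m mP]|unb] := pselect (exists m, forall n, prime_chain P n -> (n <= m)%N).
  left; have exP : exists n, `[< prime_chain P n >].
    by exists 0%N; apply/asboolP; exact: prime_chain0.
  have ubP n : `[< prime_chain P n >] -> (n <= m)%N by move=> /asboolP /mP.
  case: (ex_maxnP exP ubP) => n /asboolP Pn maxn; exists n => //.
  apply: supE; split; first by move=> _ [k /asboolP /maxn kn <-]; rewrite lee_fin.
  by move=> y; apply; exists n.
right; split; last first.
  move=> m; apply: contrapT => nex; apply: unb; exists m => n Pn.
  by rewrite leqNgt; apply/negP => mn; apply: nex; exists n => //; exact: ltnW.
apply: supE; split; first by move=> y _; exact: leey.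
move=> [a| |] // ub; last by have := ub _ S0.
exfalso; apply: unb; exists `|a|%N => n Pn.
have : ((n%:Z)%:E <= a%:E)%E by apply: ub; exists n.
by rewrite lee_fin => na; rewrite -lez_nat (le_trans na) // abszE ler_norm.
Qed.

(** The infimum defining the height exists, because nonempty sets of natural
    numbers have a minimum. *)
Lemma height_le_prime (I P : submodClosed R^o) : prime_ideal P ->
  [set` I] `<=` ([set` P] : set R) -> (height I <= prime_height P)%E.
Proof.
move=> pP IP; rewrite /height; apply: le_infimum_Nmem; last by exists P.
set S := [set _ | _ in _].
have SP : S (prime_height P) by exists P.
have Scases y : S y -> y = +oo%E \/ exists n : nat, y = (n%:Z)%:E.
  move=> [Q [pQ _] <-]; case: (prime_height_cases pQ) => [[n -> _]|[-> _]]; last by left.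
  by right; exists n.
have [[n Sn]|nfin] := pselect (exists n : nat, S (n%:Z)%:E).
  have exS : exists n, `[< S (n%:Z)%:E >] by exists n; apply/asboolP.
  case: (ex_minnP exS) => m /asboolP Sm minm; exists (m%:Z)%:E; split.
    move=> y Sy; case: (Scases y Sy) => [->|[k yE]]; first exact: leey.
    by rewrite yE lee_fin lez_nat minm //; apply/asboolP; rewrite -yE.
  by move=> y; apply.
exists +oo%E; split; last by move=> y _; exact: leey.
by move=> y Sy; case: (Scases y Sy) => [->|[k yE]] //; case: nfin; exists k; rewrite -yE.
Qed.

Lemma height_has_chain I (k : nat) (P : set R) : ((k%:Z)%:E <= height I)%E ->
  is_prime P -> [set` I] `<=` P -> has_chain set0 k P.
Proof.
move=> kI /prime_ideal_submodP [P' pP' <-] IP'.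
have := le_trans kI (height_le_prime pP' IP').
case: (prime_height_cases pP') => [[n -> Pn]|[_ unb]].
  by rewrite lee_fin lez_nat; exact: prime_chain_has_chain.
by move=> _; have [n Pn] := unb k; exact: prime_chain_has_chain.
Qed.

End Heights.

(** * Minors of presentations and primes *)

Section Fitting.
Context {R : comPzRingType}.
Implicit Types (J P : set R).

Lemma minor_ideal_ideal s r (A : 'M[R]_(s, r)) t : is_ideal (minor_ideal A t).
Proof. by rewrite /minor_ideal; case: ifP => // _; exact: ideal_gen_ideal. Qed.

(** The r - t generators off the columns h lie in P, so a chain of length
    r - t + 1 can be exchanged for a prime strictly below P containing them; that
    prime still avoids the minor, hence contains J by Cramer's rule. *)
Lemma pres_descend J s r t (x : 'cV[R]_r) (A : 'M[R]_(s, r)) P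
    (g : 'I_t -> 'I_s) (h : 'I_t -> 'I_r) : noetherian R ->
  is_presentation J x A -> injective h -> is_prime P -> J `<=` P ->
  ~ P (\det (mxsub g h A)) -> has_chain set0 (r - t).+1 P ->
  exists P', [/\ is_prime P', P' `<` P & J `<=` P'].
Proof.
move=> nR pres injh pP JP nPd.
pose ys := [seq x c 0 | c <- enum [predC codom h]].
have -> : (r - t).+1 = (size ys + 1)%N.
  rewrite size_map -cardE addn1; congr _.+1.
  have := cardC (mem (codom h)); rewrite card_codom // !card_ord => cE.
  by rewrite -[X in (X - _)%N]cE addKn.
move=> /krull_height -/(_ nR) [|_ [P' P'P [pP' yP']]].
  by move=> y /mapP [c _ ->]; apply: JP; exact: pres_mem pres.
exists P'; split=> //; apply: (pres_sub_ideal pres); first by case: pP'.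
apply: (minor_cramer (A := A) (g := g) pP' injh); first by case: pres.
  by move=> /P'P.1.
by move=> c ch; apply: yP'; right; apply/mapP; exists c; rewrite ?mem_enum.
Qed.

(** Otherwise [pres_descend] would apply again and again below P, and P would
    have infinite height. *)
Lemma pres_minor_in_prime J s r t (x : 'cV[R]_r) (A : 'M[R]_(s, r))
    (g : 'I_t -> 'I_s) (h : 'I_t -> 'I_r) : noetherian R ->
  is_presentation J x A -> injective h ->
  (forall P, is_prime P -> J `<=` P -> has_chain set0 (r - t).+1 P) ->
  forall P, is_prime P -> J `<=` P -> P (\det (mxsub g h A)).
Proof.
move=> nR pres injh htJ P pP JP; apply: contrapT => nPd.
have [n] := prime_finite_height set0 nR pP; apply.
elim: n P pP JP nPd => [|n IH] P pP JP nPd; first by split.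
have [P' [pP' P'P JP']] := pres_descend nR pres injh pP JP nPd (htJ P pP JP).
split=> //; exists P' => //; apply: IH => // /P'P.1; exact: nPd.
Qed.

End Fitting.

(** * Fitting ideals and the radical *)

Theorem theorem4p1 (R : comPzRingType) (I : submodClosed R^o) (h : \bar int)
    (noethR : noetherian R) (heightI : height I = h)
    (j : int) (j_ge1 : 1 <= j) (j_le : (j%:E <= h - 1%:E)%E) :
  radical (Fitt (ideal_module I) j) = radical ([set` I] : set R).
Proof.
have [s [r [x [A [pres ->]]]]] := @Fitt_presentation R I j noethR.
case: j j_ge1 j_le => // j; rewrite lez_nat => j_gt0 j_le.
have jI : ((j.+1%:Z)%:E <= height I)%E.
  rewrite heightI; case: h j_le {heightI} => [h| |] jh; [|exact: leey|by []].
  by move: jh; rewrite -EFinB !lee_fin lerBrDr -addn1 PoszD.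
pose F := minor_ideal A (r%:Z - j%:Z).
have iI := submod_is_ideal I; have iF : is_ideal F := minor_ideal_ideal A _.
have FE : (j < r)%N -> forall P, is_ideal P -> (F `<=` P <->
    forall (g : 'I_(r - j) -> 'I_s) (h : 'I_(r - j) -> 'I_r),
      increasing g -> increasing h -> P (\det (mxsub g h A))).
  move=> jr P iP; rewrite /F subzn ?(ltnW jr) // /minor_ideal.
  rewrite lez_nat leqn0 subn_eq0 leqNgt jr /=; split=> [FP g k ig ik|minP].
    by apply: FP; apply: sub_ideal_gen; exists g, k; split.
  by apply: ideal_gen_sub => // _ [g [k [ig ik ->]]]; exact: minP.
have F1 : (r <= j)%N -> F 1 by move=> rj; rewrite /F /minor_ideal subr_le0 lez_nat rj.
apply/seteqP; split=> a [n an].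
- apply: radical_prime => // P pP IP; apply: (prime_exp pP (n := n)).
  have [jr|rj] := ltnP j r.
    have [iP _ _] := pP; apply: (((FE jr) P iP).2 _ _ an) => g k ig ik.
    apply: (pres_minor_in_prime g noethR pres (increasing_inj ik) _ pP IP).
    by move=> Q pQ IQ; rewrite subKn ?(ltnW jr) //; exact: height_has_chain jI pQ IQ.
  (* When r <= j, the relevant minor is the empty one, equal to 1. *)
  have [_ nP1 _] := pP; case: nP1.
  have e m : 'I_0 -> 'I_m by case.
  rewrite -(det_mx00 (mxsub (e s) (e r) A)).
  apply: (pres_minor_in_prime (e s) noethR pres _ _ pP IP); first by case.
  move=> Q pQ IQ; apply: height_has_chain pQ IQ; apply: le_trans jI.
  by rewrite subn0 lee_fin lez_nat.
- apply: radical_prime => // P pP FP; apply: (prime_exp pP (n := n)).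
  have [jr|rj] := ltnP j r; last by case: (pP) => _ []; exact: FP (F1 rj).
  have [iP _ _] := pP.
  apply: (pres_minor_sub pres (t := r - j) _ pP _ an); last exact/FE.
  by rewrite ltn_subrL j_gt0 (leq_ltn_trans _ jr).
Qed.
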